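(* Let $M$ be an irreducible highest weight $\widehat{\mathcal A}$-module with highest weight $\xi\in(\widehat{\mathcal A}_0)^*$, and let $v_\xi$ be a non-zero highest weight vector. Then the following are equivalent: (i) $M$ is quasi-finite; (ii) $\widehat{\mathcal A}_{-\frac12}v_\xi$ is finite dimensional; (iii) there exists $N\in\mathbb N$ such that $\xi=\sum_{j\in\frac12\mathbb Z^*,\ |j|\le N}\xi_j\omega_j+d\Lambda_0$ for some $\xi_j,d\in\mathbb C$.
   Context: All vector spaces are over $\mathbb C$; $\mathbb N=\{1,2,\dots\}$, $\mathbb Z_+=\{0,1,2,\dots\}$, $\mathbb Z^*=\mathbb Z\setminus\{0\}$, $\frac12\mathbb Z^*=\frac12\mathbb Z\setminus\{0\}$. Let $\mathrm{gl}_{\infty|\infty}$ be the space of complex matrices $(a_{ij})_{i,j\in\frac12\mathbb Z}$ with $a_{ij}=0$ for $|i-j|\gg0$; $e_{pq}$ denotes the matrix unit. It is $\frac12\mathbb Z$-graded: the degree-$k$ component consists of all $\sum_{j\in\frac12\mathbb Z}a_je_{j-k,j}$ ($a_j\in\mathbb C$ arbitrary). Elements of integer degree are even, elements of degree in $\frac12+\mathbb Z$ are odd, and $[A,B]=AB-(-1)^{|A||B|}BA$. Let $J=\sum_{r\le0}e_{rr}$, $\mathrm{Str}(D)=\sum_{r\in\frac12\mathbb Z}(-1)^{2r}d_{rr}$, $\alpha(A,B)=\mathrm{Str}([J,A]B)$. Then $\widehat{\mathrm{gl}}_{\infty|\infty}=\mathrm{gl}_{\infty|\infty}\oplus\mathbb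 CC$ is the central extension with $C$ even, central, of degree $0$, and the bracket of $A,B\in \mathrm{gl}_{\infty|\infty}$ equal to $[A,B]+\alpha(A,B)C$. Let $\mathcal A=\{(a_{ij})\in\mathrm{gl}_{\infty|\infty}: a_{ij}=0\text{ if }i=0\text{ or }j=0\}$ and $\widehat{\mathcal A}=\mathcal A\oplus\mathbb CC\subset\widehat{\mathrm{gl}}_{\infty|\infty}$, with the induced grading. For a $\frac12\mathbb Z$-graded Lie superalgebra $\mathfrak g=\bigoplus_j\mathfrak g_j$ with $\mathfrak g_0$ abelian, put $\mathfrak g_\pm=\bigoplus_{r>0}\mathfrak g_{\pm r}$. A highest weight module with highest weight $\xi\in\mathfrak g_0^*$ is a module $M$ containing a non-zero vector $v_\xi$ (highest weight vector) with $hv_\xi=\xi(h)v_\xi$ for $h\in\mathfrak g_0$, $\mathfrak g_+v_\xi=0$, $\mathcal U(\mathfrak g_-)v_\xi=M$. It is graded, $M=\bigoplus_{j\in\frac12\mathbb Z_+}M_{-j}$, by giving $v_\xi$ degree $0$. $M$ is quasi-finite if $\dim M_j<\infty$ for all $j$. The weights $\omega_s$ ($s\in\frac12\mathbb Z^*$) and $\Lambda_0$ in $(\widehat{\mathcal A}_0)^*$ are defined by $\omega_s(\sum_{r\in\frac12\mathbb Z^*}a_re_{rr}+dC)=a_s$, $\Lambda_0(\sum_{r\in\frac12\mathbb Z^*}a_re_{rr}+dC)=d$. *)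

(* Defs.v *)
From HB Require Import structures.
From mathcomp Require Import all_boot all_order all_algebra.
From mathcomp Require Import boolp classical_sets functions cardinality fsbigop.

Set Implicit Arguments.
Unset Strict Implicit.
Unset Printing Implicit Defensive.

Import Order.TTheory GRing.Theory Num.Theory.
Local Open Scope classical_set_scope.
Local Open Scope ring_scope.

(* Half-integers are encoded by their doubles: n : int stands for n / 2.  This
   applies both to matrix indices and to degrees, so "integer degree" reads
   "even n" and (-1)^{2r} reads (-1)^n.  A sum over all half-integers is a
   finitely supported sum \sum_(j \in setT); its value is meaningful only when
   the support is finite, which holds for every such sum below, because all the
   matrices involved are banded. *)

Section BandedMatrices.
Variable K : fieldType.

Definition imatrix : Type := int -> int -> K^o.
Identity Coercion imatrix_Funclass : imatrix >-> Funclass.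

Implicit Types a b : imatrix.

Definition banded a : Prop :=
  exists N : nat, forall i j : int, (N < `|i - j|)%N -> a i j = 0.

Definition mul_imx a b : imatrix :=
  fun i k => \sum_(j \in [set: int]) (a i j * b j k).

Definition imx_part (p : bool) a : imatrix :=
  fun i j => if odd `|i - j|%N == p then a i j else 0.

(* [A, B] = A B - (-1)^{|A||B|} B A for homogeneous A and B, extended
   bilinearly through A = A_even + A_odd. *)
Definition sbracket_imx a b : imatrix := fun i k =>
  \sum_(p : bool) \sum_(q : bool)
    (mul_imx (imx_part p a) (imx_part q b) i k
     - (-1) ^+ (p && q) * mul_imx (imx_part q b) (imx_part p a) i k).

Definition J_imx : imatrix := fun i j => ((i == j) && (i <= 0))%:R.

Definition Str_imx a : K := \sum_(r \in [set: int]) ((-1) ^+ `|r|%N * a r r).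

Definition cocycle_imx a b : K := Str_imx (mul_imx (sbracket_imx J_imx a) b).

Lemma mul_imx_banded a b : banded a -> banded b -> banded (mul_imx a b).
Proof.
move=> [N aN] [M bM]; exists (N + M)%N => i k ltNM.
rewrite /mul_imx fsbig1 // => j _.
have [/aN->|leN] := ltnP N `|i - j|%N; first by rewrite mul0r.
have [/bM->|leM] := ltnP M `|j - k|%N; first by rewrite mulr0.
move: ltNM; rewrite ltnNge => /negP[].
by apply: leq_trans (leqD_dist i j k) (leq_add leN leM).
Qed.

Lemma imx_part_banded p a : banded a -> banded (imx_part p a).
Proof. by move=> [N aN]; exists N => i j /aN; rewrite /imx_part; case: ifP. Qed.

Lemma banded_sub a b (c : K) :
  banded a -> banded b -> banded (fun i j => a i j - c * b i j).
Proof.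
move=> [N aN] [M bM]; exists (maxn N M) => i j.
by rewrite gtn_max => /andP[/aN-> /bM->]; rewrite mulr0 subr0.
Qed.

Lemma sbracket_imx_banded a b :
  banded a -> banded b -> banded (sbracket_imx a b).
Proof.
move=> ha hb.
have banded_sum (F : bool -> imatrix) :
    (forall p, banded (F p)) -> banded (fun i k => \sum_(p : bool) F p i k).
  move=> hF; have [N FN] := hF true; have [M FM] := hF false.
  exists (maxn N M) => i k; rewrite gtn_max big_bool => /andP[/FN-> /FM->].
  by rewrite /= addr0.
apply: (banded_sum) => p; apply: banded_sum => q.
by apply: banded_sub; apply: mul_imx_banded; apply: imx_part_banded.
Qed.

Definition gl_pred : {pred imatrix} := fun a => `[< banded a >].

Lemma gl_submod_closed : submod_closed gl_pred.
Proof.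
split=> [|c a b /asboolP[N aN] /asboolP[M bM]]; apply/asboolP; first by exists 0%N.
exists (maxn N M) => i j; rewrite gtn_max => /andP[ltN ltM].
have -> : (c *: a + b) i j = c * a i j + b i j by [].
by rewrite aN // bM // mulr0 addr0.
Qed.

HB.instance Definition _ :=
  GRing.isSubmodClosed.Build K imatrix gl_pred gl_submod_closed.

Record gl := Gl { gl_val :> imatrix; gl_valP : gl_val \in gl_pred }.

HB.instance Definition _ := [isSub for gl_val].
HB.instance Definition _ := [Choice of gl by <:].
HB.instance Definition _ := [SubChoice_isSubLmodule of gl by <:].

(* The pair (A, d) stands for A + d C. *)
Local Notation hatgl := (gl * K^o)%type.

Lemma sbracket_gl_subproof (A B : gl) : sbracket_imx A B \in gl_pred.
Proof.
have /asboolP hA := gl_valP A; have /asboolP hB := gl_valP B.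
by apply/asboolP/sbracket_imx_banded.
Qed.

Definition sbracket_gl (A B : gl) : gl := Gl (sbracket_gl_subproof A B).

Definition bracket_hatgl (x y : hatgl) : hatgl :=
  (sbracket_gl x.1 y.1, cocycle_imx x.1 y.1).

(* The degree-k matrices are the sums of a_j e_{j-k,j}; C has degree 0. *)
Definition hatgl_deg (k : int) : set hatgl :=
  [set x : hatgl | (forall i j : int, j - i != k -> x.1 i j = 0)
           /\ (k != 0 -> x.2 = 0)].

Definition hatA_pred : {pred hatgl} :=
  fun x : hatgl => `[< forall i j : int, i = 0 \/ j = 0 -> x.1 i j = 0 >].

Lemma hatA_submod_closed : submod_closed hatA_pred.
Proof.
split=> [|c x y /asboolP hx /asboolP hy]; apply/asboolP=> // i j ij0.
have -> : (c *: x + y).1 i j = c * x.1 i j + y.1 i j by [].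
by rewrite hx // hy // mulr0 addr0.
Qed.

HB.instance Definition _ :=
  GRing.isSubmodClosed.Build K hatgl hatA_pred hatA_submod_closed.

Record hatA := HatA { hatA_val :> hatgl; hatA_valP : hatA_val \in hatA_pred }.

HB.instance Definition _ := [isSub for hatA_val].
HB.instance Definition _ := [Choice of hatA by <:].
HB.instance Definition _ := [SubChoice_isSubLmodule of hatA by <:].

Lemma bracket_hatA_subproof (x y : hatA) : bracket_hatgl x y \in hatA_pred.
Proof.
have /asboolP hx := hatA_valP x; have /asboolP hy := hatA_valP y.
apply/asboolP => i j ij0 /=.
have mul0 (p q : bool) (a b : imatrix) :
    (forall i j : int, i = 0 \/ j = 0 -> a i j = 0) ->
    (forall i j : int, i = 0 \/ j = 0 -> b i j = 0) ->
    mul_imx (imx_part p a) (imx_part q b) i j = 0.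
  move=> ha hb; rewrite /mul_imx fsbig1 // => k _; rewrite /imx_part.
  case: ij0 => [i0|j0].
    by rewrite (ha i k); [rewrite if_same mul0r | left].
  by rewrite (hb k j); [rewrite if_same mulr0 | right].
rewrite /sbracket_imx big1 // => p _; rewrite big1 // => q _.
by rewrite !mul0 // mulr0 subr0.
Qed.

Definition bracket_hatA (x y : hatA) : hatA := HatA (bracket_hatA_subproof x y).

Definition hatA_deg (k : int) : set hatA := [set x | hatgl_deg k x].

Definition hatA0_pred : {pred hatA} := fun x => `[< hatA_deg 0 x >].

Lemma hatA0_submod_closed : submod_closed hatA0_pred.
Proof.
split=> [|c x y /asboolP[hx _] /asboolP[hy _]]; apply/asboolP; split=> // i j ij.
have -> : (hatA_val (c *: x + y)).1 i j =
  c * (hatA_val x).1 i j + (hatA_val y).1 i j by [].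
by rewrite hx // hy // mulr0 addr0.
Qed.

HB.instance Definition _ :=
  GRing.isSubmodClosed.Build K hatA hatA0_pred hatA0_submod_closed.

Record hatA0 := HatA0 { hatA0_val :> hatA; hatA0_valP : hatA0_val \in hatA0_pred }.

HB.instance Definition _ := [isSub for hatA0_val].
HB.instance Definition _ := [Choice of hatA0 by <:].
HB.instance Definition _ := [SubChoice_isSubLmodule of hatA0 by <:].

Definition omega (s : int) (h : hatA0) : K^o := (hatA_val h).1 s s.
Definition Lambda0 (h : hatA0) : K^o := (hatA_val h).2.

Lemma omega_is_linear s : linear (omega s). Proof. by []. Qed.
Lemma Lambda0_is_linear : linear Lambda0. Proof. by []. Qed.

HB.instance Definition _ s :=
  GRing.isLinear.Build K hatA0 K^o _ (omega s) (omega_is_linear s).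
HB.instance Definition _ :=
  GRing.isLinear.Build K hatA0 K^o _ Lambda0 Lambda0_is_linear.

End BandedMatrices.

Arguments omega {K} s h.
Arguments Lambda0 {K} h.

Section LinearSpan.
Variables (K : fieldType) (V : lmodType K).

Definition lspan (S : set V) : set V :=
  [set u | exists (n : nat) (c : 'I_n -> K) (w : 'I_n -> V),
     (forall i, S (w i)) /\ u = \sum_i c i *: w i].

Definition subspace (S : set V) : Prop :=
  S 0 /\ forall (c : K) (u w : V), S u -> S w -> S (c *: u + w).

Definition finite_dimensional (S : set V) : Prop :=
  exists s : seq V, S = lspan [set` s].

End LinearSpan.

Section Modules.
Variables (K : fieldType) (V : lmodType K).
Implicit Types (Vp : bool -> set V) (rho : hatA K -> V -> V).

Definition super_space Vp : Prop :=
  (forall p, subspace (Vp p)) /\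
  forall u : V, exists! w : V * V,
    [/\ Vp false w.1, Vp true w.2 & u = w.1 + w.2].

(* By bilinearity it is enough to state the bracket relation on homogeneous
   elements, of which every element is a finite sum. *)
Record hatA_module Vp rho : Prop := HatAModule {
  hatA_module_super : super_space Vp;
  hatA_module_linearl : forall u, linear (rho ^~ u);
  hatA_module_linearr : forall x, linear (rho x);
  hatA_module_parity : forall (m : int) (p : bool) (x : hatA K) (u : V),
    hatA_deg m x -> Vp p u -> Vp (odd `|m|%N (+) p) (rho x u);
  hatA_module_bracket : forall (m n : int) (x y : hatA K) (u : V),
    hatA_deg m x -> hatA_deg n y ->
    rho (bracket_hatA x y) u =
      rho x (rho y u)
      - (-1) ^+ (odd `|m|%N && odd `|n|%N) *: rho y (rho x u) }.

Definition hatA_submodule Vp rho (W : set V) : Prop :=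
  [/\ subspace W,
      forall (x : hatA K) (u : V), W u -> W (rho x u)
    & forall u0 u1 : V, Vp false u0 -> Vp true u1 -> W (u0 + u1) ->
        W u0 /\ W u1].

Definition irreducible_module Vp rho : Prop :=
  (exists u : V, u != 0) /\
  forall W : set V, hatA_submodule Vp rho W -> W = [set 0] \/ W = [set: V].

Definition hatA_pos : set (hatA K) :=
  lspan (\bigcup_(k in [set k : int | 0 < k]) hatA_deg k).
Definition hatA_neg : set (hatA K) :=
  lspan (\bigcup_(k in [set k : int | k < 0]) hatA_deg k).

(* U(g_-) is spanned by the products x_1 ... x_n of elements of g_-, so U(g_-) v
   is the span of the vectors x_1 (... (x_n v)). *)
Definition U_neg_orbit rho (v : V) : set V :=
  lspan [set u | exists xs : seq (hatA K),
           (forall x, x \in xs -> hatA_neg x) /\ u = foldr rho v xs].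

Definition highest_weight_vector rho (xi : {scalar hatA0 K}) (v : V) : Prop :=
  [/\ v != 0,
      forall h : hatA0 K, rho h v = xi h *: v,
      forall x, hatA_pos x -> rho x v = 0
    & U_neg_orbit rho v = [set: V]].

(* M_k, for the grading in which v has degree 0: the span of the vectors
   x_1 (... (x_n v)) with the x_i in g_- homogeneous of total degree k. *)
Definition module_deg rho (v : V) (k : int) : set V :=
  lspan [set u | exists xs : seq (int * hatA K),
           [/\ forall x, x \in xs -> x.1 < 0 /\ hatA_deg x.1 x.2,
               \sum_(x <- xs) x.1 = k
             & u = foldr (fun x => rho x.2) v xs]].

Definition quasi_finite rho (v : V) : Prop :=
  forall k : int, finite_dimensional (module_deg rho v k).

End Modules.

(* Main.v *)
Require Import Defs.
From HB Require Import structures.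
From mathcomp Require Import all_boot all_order all_algebra.
From mathcomp Require Import boolp classical_sets functions cardinality fsbigop reals.
From mathcomp Require Import complex zify ring.

Set Implicit Arguments.
Unset Strict Implicit.
Unset Printing Implicit Defensive.

Import Order.TTheory GRing.Theory Num.Theory.
Local Open Scope classical_set_scope.
Local Open Scope ring_scope.

(* Call an element of degree m far if all its entries lie far from the origin.
   If xi ignores the far diagonal entries, then x v = 0 for every far x:
   a bracket with a far element is again far, so the vectors x v with x far of
   negative degree are sent by U(g_+) into far weights, which vanish, and they
   generate a proper submodule.  Commuting x past the letters of a word, far
   elements also kill every word of a given degree, so only finitely many matrix
   units of each degree are needed to produce M_k from the M_j with k < j <= 0,
   and M_k is finite dimensional by induction.

   Conversely, if g_{-1/2} v is finite dimensional, the vectors given by the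
   coefficient sequences i^n are dependent, so some x with coefficients p(i), p a
   nonzero polynomial, kills v.  As p(i) is nonzero for large |i|, the brackets
   [y, x] with y in g_{1/2} reach all far diagonal matrices, on which xi must
   then vanish. *)

(** * Linear spans and linear dependence *)

Section LinearSpanTheory.
Variables (K : fieldType) (V : lmodType K).
Implicit Types (S W : set V).

Lemma subspace_sum W (I : Type) (r : seq I) (P : pred I) (F : I -> V) :
  subspace W -> (forall i, P i -> W (F i)) -> W (\sum_(i <- r | P i) F i).
Proof.
move=> [W0 WD] WF; elim/big_rec: _ => // i u Pi Wu.
by rewrite -[F i]scale1r; apply: WD => //; apply: WF.
Qed.

Lemma subspaceZ W (c : K) u : subspace W -> W u -> W (c *: u).
Proof. by move=> [W0 WD] Wu; rewrite -[_ *: _]addr0; apply: WD. Qed.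

Lemma subspaceD W u w : subspace W -> W u -> W w -> W (u + w).
Proof. by move=> [W0 WD] Wu Ww; rewrite -[u]scale1r; apply: WD. Qed.

Lemma sub_lspan S u : S u -> lspan S u.
Proof.
by move=> Su; exists 1%N, (fun=> 1), (fun=> u); rewrite big_ord1 scale1r.
Qed.

Lemma lspan_subspace S : subspace (lspan S).
Proof.
split; first by exists 0%N, (fun=> 0), (fun=> 0); rewrite big_ord0; split=> // -[].
move=> c _ _ [n [a [u [Su ->]]]] [m [b [w [Sw ->]]]].
exists (n + m)%N,
  (fun i => match fintype.split i with inl j => c * a j | inr j => b j end),
  (fun i => match fintype.split i with inl j => u j | inr j => w j end).
split=> [i|]; first by case: fintype.splitP.
rewrite big_split_ord scaler_sumr; congr (_ + _); apply: eq_bigr => i _.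
  by rewrite -/(unsplit (inl i)) unsplitK scalerA.
by rewrite -/(unsplit (inr i)) unsplitK.
Qed.

Lemma lspan_min S W : subspace W -> S `<=` W -> lspan S `<=` W.
Proof.
move=> hW SW _ [n [a [u [Su ->]]]]; apply: subspace_sum => // i _.
by apply: subspaceZ => //; apply: SW.
Qed.

Lemma lspan_seqP (s : seq V) u :
  lspan [set` s] u -> exists c : 'I_(size s) -> K, u = \sum_i c i *: s`_i.
Proof.
move=> [n [a [w [ws ->]]]].
have wi i : (index (w i) s < size s)%N by rewrite index_mem; apply: ws.
(* Coefficients of vectors with the same first position in [s] are added up, so repetitions do no
   harm. *)
exists (fun j => \sum_(i | j == Ordinal (wi i)) a i).
under [RHS]eq_bigr do rewrite scaler_suml.
rewrite (exchange_big_dep predT) //=; apply: eq_bigr => i _.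
by rewrite big_pred1_eq /= nth_index //; apply: ws.
Qed.

(** The coordinates of the [u i] along [s] form a matrix of rank at most [size s < n], so its left
    kernel contains a nonzero row. *)
Lemma lspan_seq_dependent (s : seq V) n (u : 'I_n -> V) :
  (size s < n)%N -> (forall i, lspan [set` s] (u i)) ->
  exists2 c : 'rV[K]_n, c != 0 & \sum_i c 0 i *: u i = 0.
Proof.
move=> sn us; have /choice[a ua] := fun i => lspan_seqP (us i).
pose A := \matrix_(i, j) a i j.
have : kermx A != 0.
  rewrite -mxrank_eq0 mxrank_ker subn_eq0 -ltnNge.
  exact: leq_ltn_trans (rank_leq_col A) sn.
move=> /rowV0Pn[c /sub_kermxP cA c0]; exists c => //.
under eq_bigr do rewrite ua scaler_sumr.
rewrite exchange_big big1 //= => j _.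
have /rowP/(_ j) := cA; rewrite !mxE => cAj.
under eq_bigr do rewrite scalerA.
rewrite -scaler_suml (_ : \sum_i _ = 0) ?scale0r // -[RHS]cAj.
by apply: eq_bigr => i _; rewrite mxE.
Qed.

End LinearSpanTheory.

(** * Integer intervals symmetric about 0 *)

Definition int_range (B : nat) : seq int :=
  [seq t%:Z - B%:Z | t <- iota 0 (B.*2 + 1)].

Lemma mem_int_range (B : nat) (i : int) : (i \in int_range B) = (`|i| <= B)%N.
Proof.
apply/mapP/idP => [[t]|iB]; first by rewrite mem_iota => tB ->; lia.
by exists (absz (i + B%:Z)%R); rewrite ?mem_iota; lia.
Qed.

Lemma int_range_uniq (B : nat) : uniq (int_range B).
Proof. by rewrite map_inj_uniq ?iota_uniq // => s t; lia. Qed.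

(** * Homogeneous elements and their brackets *)

Section Homogeneous.
Variable K : fieldType.
Implicit Types (x y z : hatA K) (m n i j k : int).

Definition ent x i j : K := (hatA_val x).1 i j.
Definition cpart x : K := (hatA_val x).2.

Lemma hatA_eq x y :
  (forall i j, ent x i j = ent y i j) -> cpart x = cpart y -> x = y.
Proof.
move=> exy cxy; apply/val_inj; case: x y exy cxy => [[a d] ?] [[b e] ?] exy cxy.
congr pair; last exact: cxy.
by apply/val_inj/funext => i; apply/funext => j; apply: exy.
Qed.

Lemma ent_linear c x y i j : ent (c *: x + y) i j = c * ent x i j + ent y i j.
Proof. by []. Qed.

Lemma cpart_linear c x y : cpart (c *: x + y) = c * cpart x + cpart y.
Proof. by []. Qed.

Lemma entZ c x i j : ent (c *: x) i j = c * ent x i j.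
Proof. by []. Qed.

Lemma cpartZ c x : cpart (c *: x) = c * cpart x.
Proof. by []. Qed.

Lemma ent_sum (I : Type) (r : seq I) (F : I -> hatA K) i j :
  ent (\sum_(t <- r) F t) i j = \sum_(t <- r) ent (F t) i j.
Proof.
elim: r => [|t r IHr]; rewrite ?big_nil // !big_cons.
by rewrite -[F t]scale1r ent_linear IHr mul1r scale1r.
Qed.

Lemma cpart_sum (I : Type) (r : seq I) (F : I -> hatA K) :
  cpart (\sum_(t <- r) F t) = \sum_(t <- r) cpart (F t).
Proof.
elim: r => [|t r IHr]; rewrite ?big_nil // !big_cons.
by rewrite -[F t]scale1r cpart_linear IHr mul1r scale1r.
Qed.

Lemma ent_axis x i j : i = 0 \/ j = 0 -> ent x i j = 0.
Proof. by have /asboolP := hatA_valP x; apply. Qed.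

Lemma ent_deg m x i j : hatA_deg m x -> j != i + m -> ent x i j = 0.
Proof. by move=> [h _] jim; apply: h; rewrite subr_eq addrC. Qed.

Lemma cpart_deg m x : hatA_deg m x -> m != 0 -> cpart x = 0.
Proof. by move=> [_]. Qed.

Lemma hatA_deg_subspace m : subspace (@hatA_deg K m).
Proof.
split=> [|c x y [x1 x2] [y1 y2]]; first by split.
split=> [i j ij|m0]; first by rewrite -/(ent _ i j) ent_linear /ent x1 // y1 // mulr0 addr0.
by rewrite -/(cpart _) cpart_linear /cpart x2 // y2 // mulr0 addr0.
Qed.

Lemma diagA_gl_subproof m (a : int -> K) :
  ((fun i j => if [&& j - i == m, i != 0 & j != 0] then a i else 0) : imatrix K)
    \in gl_pred (K:=K).
Proof.
apply/asboolP; exists `|m|%N => i j ij; case: ifP => // /and3P[/eqP jim _ _]; lia.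
Qed.

Lemma diagA_subproof m (a : int -> K) (d : K) :
  (Gl (diagA_gl_subproof m a), if m == 0 then d else 0) \in hatA_pred (K:=K).
Proof. by apply/asboolP=> i j [] ->; rewrite /= ?andbF. Qed.

(** The sum of a_i e_{i,i+m} plus d C, cut down so that any data give a homogeneous element of
    degree m: entries in row or column 0 are dropped, and so is d unless m = 0. The sequence is
    indexed by rows. *)
Definition diagA m a d : hatA K := HatA (diagA_subproof m a d).

Lemma ent_diagA m a d i j :
  ent (diagA m a d) i j = if [&& j - i == m, i != 0 & j != 0] then a i else 0.
Proof. by []. Qed.

Lemma cpart_diagA m a d : cpart (diagA m a d) = if m == 0 then d else 0.
Proof. by []. Qed.

Lemma diagA_deg m a d : hatA_deg m (diagA m a d).
Proof.
by split=> [i j|] /negPf h; rewrite -?/(ent _ _ _) -?/(cpart _) /ent /cpart /= h.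
Qed.

Lemma fsbig_only1 (F : int -> K) i :
  (forall j, j != i -> F j = 0) -> \sum_(j \in [set: int]) F j = F i.
Proof.
move=> Fi; rewrite -(fsbig_widen [set i]) ?fsbig_set1 //.
by move=> j [_ /= /eqP]; exact: Fi.
Qed.

Lemma mul_imx_deg (a b : imatrix K) m i k :
  (forall i j, j != i + m -> a i j = 0) ->
  mul_imx a b i k = a i (i + m) * b (i + m) k.
Proof.
move=> am; rewrite /mul_imx (@fsbig_only1 _ (i + m)) // => j /am->.
by rewrite mul0r.
Qed.

Lemma imx_part_deg (a : imatrix K) m p :
  (forall i j, j != i + m -> a i j = 0) ->
  imx_part p a = if odd `|m| == p then a else fun _ _ => 0.
Proof.
move=> am; apply/funext => i; apply/funext => j; rewrite /imx_part.
have [->|jim] := eqVneq j (i + m); last by case: ifP; case: ifP; rewrite ?am.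
have -> : absz (i - (i + m))%R = absz m by lia.
by case: ifP.
Qed.

Lemma mul0_imx (a : imatrix K) i k : mul_imx (fun _ _ => 0) a i k = 0.
Proof. by rewrite /mul_imx fsbig1 // => j _; rewrite mul0r. Qed.

Lemma mul_imx0 (a : imatrix K) i k : mul_imx a (fun _ _ => 0) i k = 0.
Proof. by rewrite /mul_imx fsbig1 // => j _; rewrite mulr0. Qed.

Lemma sbracket_imx_deg (a b : imatrix K) m n i k :
  (forall i j, j != i + m -> a i j = 0) -> (forall i j, j != i + n -> b i j = 0) ->
  sbracket_imx a b i k = a i (i + m) * b (i + m) k
    - (-1) ^+ (odd `|m| && odd `|n|) * (b i (i + n) * a (i + n) k).
Proof.
move=> am bn; rewrite /sbracket_imx !big_bool.
rewrite !(imx_part_deg _ am) !(imx_part_deg _ bn).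
by case: (odd `|m|); case: (odd `|n|) => /=;
  rewrite ?mul0_imx ?mul_imx0 ?mulr0 ?subr0 ?add0r ?addr0 (mul_imx_deg _ _ _ am)
    (mul_imx_deg _ _ _ bn).
Qed.

Lemma ent_bracket m n x y i k : hatA_deg m x -> hatA_deg n y ->
  ent (bracket_hatA x y) i k = ent x i (i + m) * ent y (i + m) k
    - (-1) ^+ (odd `|m| && odd `|n|) * (ent y i (i + n) * ent x (i + n) k).
Proof.
by move=> xm yn; apply: sbracket_imx_deg => i' j; apply: ent_deg.
Qed.

(** Commuting with the diagonal [J_imx] multiplies the entry (r, r + m) by a difference of
    indicators, so the cocycle only sees entries with exactly one index <= 0. *)
Lemma cpart_bracket m x y : hatA_deg m x ->
  cpart (bracket_hatA x y) =
  \sum_(r \in [set: int]) (-1) ^+ `|r|%N *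
    ((((r <= 0)%R)%:R - ((r + m <= 0)%R)%:R) * ent x r (r + m) * ent y (r + m) r).
Proof.
move=> xm; rewrite /cpart /= /cocycle_imx /Str_imx; apply: eq_fsbigr => r _.
have J0 i j : j != i + 0 -> J_imx K i j = 0.
  by rewrite addr0 /J_imx eq_sym => /negPf->.
have xm' i j : j != i + m -> ent x i j = 0 by apply: ent_deg.
congr (_ * _); rewrite (@mul_imx_deg _ _ m) => [|i j ij]; last first.
  rewrite (sbracket_imx_deg _ _ J0 xm') !addr0 xm' // /J_imx.
  by rewrite [_ == j]eq_sym (negPf ij) /= !mulr0 subr0.
rewrite (sbracket_imx_deg _ _ J0 xm') !addr0 /J_imx !eqxx /= expr0 mul1r.
by congr (_ * _); rewrite mulrBl [ent x r _ * (_)%:R]mulrC.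
Qed.

Lemma bracket_deg m n x y : hatA_deg m x -> hatA_deg n y ->
  hatA_deg (m + n) (bracket_hatA x y).
Proof.
move=> xm yn; split=> [i j|mn0]; rewrite -?/(ent _ _ _) -?/(cpart _).
  rewrite subr_eq addrC addrA => jimn; rewrite (ent_bracket _ _ xm yn).
  rewrite (ent_deg yn) // [ent x (i + n) j](ent_deg xm); last by rewrite addrAC.
  by rewrite !mulr0 subr0.
rewrite (cpart_bracket _ xm) fsbig1 // => r _; rewrite (ent_deg yn) ?mulr0 //.
by apply: contra_neq mn0; lia.
Qed.

(** * Far elements and decompositions into simpler pieces *)

Definition far (D : nat) x : Prop :=
  cpart x = 0 /\ forall i j, (`|i|%N <= D)%N || (`|j|%N <= D)%N -> ent x i j = 0.

Lemma far_le (D E : nat) x : (D <= E)%N -> far E x -> far D x.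
Proof. by move=> DE [cx xE]; split=> // i j ij; apply: xE; lia. Qed.

(** Multiplying by an element of degree m moves one index by |m|, so the radius drops by at most
    |m|. *)
Lemma far_bracket (D : nat) m n x y : (`|m| <= D)%N ->
  hatA_deg m y -> hatA_deg n x -> far D x -> far (D - `|m|) (bracket_hatA y x).
Proof.
move=> mD ym xn [cx xD]; split.
  rewrite (cpart_bracket _ ym) fsbig1 // => r _.
  have [rD|rD] := boolP ((`|r| <= D)%N || (absz (r + m)%R <= D)%N).
    by rewrite (xD (r + m)%R r) ?mulr0 //; lia.
  (* Here |r| > D >= |m|, so r and r + m have the same sign and the cocycle term vanishes. *)
  have -> : (r + m <= 0)%R = (r <= 0)%R by lia.
  by rewrite subrr !mul0r mulr0.
move=> i j ij; rewrite (ent_bracket _ _ ym xn).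
have [jE|jimn] := eqVneq j (i + n + m); last first.
  rewrite (ent_deg ym jimn) (@ent_deg n x) // ?mulr0 ?subr0 //.
  by apply: contra_neq jimn; lia.
by rewrite (xD (i + m)%R) ?(xD i (i + n)%R) ?mulr0 ?mul0r ?mulr0 ?subr0 //; lia.
Qed.

(** The matrix unit e_{i,i+m}, which becomes 0 when i or i + m is 0. *)
Definition mx_unit m i := diagA m (fun i' => (i' == i)%:R) 0.

(** A homogeneous matrix has at most one entry per row, so the rows up to B contribute finitely many
    matrix units. The central part stays in the remainder. *)
Lemma near_far_decomposition m (B : nat) x : hatA_deg m x ->
  exists y, [/\ hatA_deg m y, cpart y = cpart x,
    forall i j, (`|i| <= B)%N -> ent y i j = 0
    & x = \sum_(i <- int_range B) ent x i (i + m) *: mx_unit m i + y].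
Proof.
move=> xm; pose s := \sum_(i <- int_range B) ent x i (i + m) *: mx_unit m i.
have sm : hatA_deg m s.
  apply: subspace_sum => [|i _]; first exact: hatA_deg_subspace.
  by apply: subspaceZ (diagA_deg _ _ _); apply: hatA_deg_subspace.
exists (- 1 *: s + x); split; last by rewrite scaleN1r addNKr.
- by case: (hatA_deg_subspace m) => _; apply.
- rewrite cpart_linear cpart_sum big1 ?mulr0 ?add0r // => i _.
  by rewrite cpartZ cpart_diagA if_same mulr0.
move=> i j iB; rewrite ent_linear ent_sum (bigD1_seq i) ?mem_int_range ?int_range_uniq //=.
rewrite big1 => [|i' ii']; rewrite entZ ent_diagA.
  rewrite eqxx addr0 mulN1r; have [jim|jim] := eqVneq j (i + m); last first.
    rewrite ifF ?(ent_deg xm jim) ?mulr0 ?oppr0 ?addr0 //.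
    by rewrite subr_eq addrC (negPf jim).
  rewrite -jim [j in j - i]jim addrAC subrr add0r eqxx /=.
  by case: eqP => [->|_]; [|case: eqP => [->|_]];
    rewrite ?mulr1 ?addNr // mulr0 oppr0 add0r ent_axis //; tauto.
by rewrite /= [i == i']eq_sym (negPf ii') if_same mulr0.
Qed.

(** Bandedness leaves finitely many diagonals; the central part joins the one of degree 0. *)
Lemma homogeneous_span x : lspan (\bigcup_(m in [set: int]) @hatA_deg K m) x.
Proof.
have /asboolP[N xN] := gl_valP (hatA_val x).1.
have -> : x = \sum_(m <- int_range N)
    diagA m (fun i => ent x i (i + m)) (cpart x).
  apply: hatA_eq => [i j|]; last first.
    rewrite cpart_sum (bigD1_seq 0) ?mem_int_range ?int_range_uniq //=.
    by rewrite cpart_diagA eqxx big1 ?addr0 // => m /negPf m0; rewrite cpart_diagA m0.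
  rewrite ent_sum; have [->|i0] := eqVneq i 0.
    by rewrite ent_axis ?big1 => [//|m _|]; [rewrite ent_diagA eqxx /= andbF|left].
  have [->|j0] := eqVneq j 0.
    by rewrite ent_axis ?big1 => [//|m _|]; [rewrite ent_diagA eqxx /= !andbF|right].
  have [ijN|ijN] := leqP (absz (j - i)%R) N; last first.
    rewrite big1_seq => [|m /= mN]; first by apply: xN; lia.
    by rewrite ent_diagA ifF //; move: mN; rewrite mem_int_range; lia.
  rewrite (bigD1_seq (j - i)) ?mem_int_range ?int_range_uniq //=.
  rewrite ent_diagA eqxx i0 j0 big1 ?addr0 => [|m]; first by rewrite addrC subrK.
  by rewrite eq_sym ent_diagA => /negPf->.
apply: subspace_sum => [|m _]; first exact: lspan_subspace.
by apply: sub_lspan; exists m => //; apply: diagA_deg.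
Qed.

End Homogeneous.

(** * Auxiliary facts on polynomials, recursions and eigenvectors *)

Lemma int_roots_bounded (K : numFieldType) (p : {poly K}) : p != 0 ->
  exists B : nat, forall i : int, (B < `|i|)%N -> p.[i%:~R] != 0.
Proof.
move=> p0; apply: contrapT => noB.
have root_beyond (B : nat) : exists2 i : int, (B < `|i|)%N & root p i%:~R.
  apply: contrapT => noroot; apply: noB; exists B => i Bi.
  by apply/negP => pi; apply: noroot; exists i.
(* Choosing each root beyond all earlier ones gives [size p] distinct roots, one more than the
   degree allows. *)
have [s [us ss rs]] : exists s : seq int,
    [/\ uniq s, size s = size p & all (fun i : int => root p i%:~R) s].
  elim: (size p) => [|n [s [us ss rs]]]; first by exists [::].
  have [i Bi pi] := root_beyond (\max_(j <- s) `|j|%N).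
  exists (i :: s); split; rewrite /= ?us ?ss ?pi ?andbT //.
  by apply/negP => si; move: Bi; rewrite (big_rem i si) /= leq_gtF ?leq_maxl.
have := @max_poly_roots _ p [seq i%:~R | i <- s] p0.
rewrite all_map (map_inj_uniq (@intr_inj K)) us size_map ss ltnn.
by move=> /(_ rs isT).
Qed.

(** Here c_i + c_{i-1} will be the diagonal of a bracket of odd elements of degrees 1 and -1, whence
    the plus sign. The recursion is solved outwards from 0 in both directions. *)
Lemma telescoping_solution (K : fieldType) (h : int -> K) (B : nat) :
  (forall i : int, (`|i| <= B)%N -> h i = 0) ->
  exists c : int -> K, (forall i, c i + c (i - 1) = h i) /\
    (forall i : int, (`|i| <= B)%N || (absz (i + 1)%R <= B)%N -> c i = 0).
Proof.
move=> hB.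
(* [cp n] is c_n and [cn n] is c_{-n-1}. Both start with 0, which agrees with the equation at 0
   because h vanishes there. *)
pose cp := fix cp n : K := if n is n'.+1 then h n%:Z - cp n' else 0.
pose cn := fix cn n : K := if n is n'.+1 then h (- n%:Z) - cn n' else 0.
have cpB n : (n <= B)%N -> cp n = 0.
  by elim: n => //= n IHn nB; rewrite IHn ?(ltnW nB) // hB ?subr0.
have cnB n : (n <= B)%N -> cn n = 0.
  by elim: n => //= n IHn nB; rewrite IHn ?(ltnW nB) // hB ?subr0 //; lia.
exists (fun i => match i with Posz n => cp n | Negz n => cn n end).
split=> [[[|n]|n]|[n|n]].
- by rewrite /= add0r hB.
- by rewrite (_ : n.+1%:Z - 1 = n%:Z) /= ?subrK //; lia.
- rewrite (_ : Negz n - 1 = Negz n.+1) /=; last lia.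
  by rewrite addrC subrK NegzE.
- by move=> nB; apply: cpB; lia.
- by move=> nB; apply: cnB; lia.
Qed.

(** Applying f - mu_n deletes the last summand, rescales the others and multiplies u by the nonzero
    scalar lam - mu_n, so induction on n applies. The [mu i] may coincide. *)
Lemma eigenvectors_sum_eq0 (K : fieldType) (V : lmodType K) (f : V -> V) n
    (w : 'I_n -> V) (mu : 'I_n -> K) (lam : K) (u : V) :
  linear f -> (forall i, f (w i) = mu i *: w i) -> (forall i, mu i != lam) ->
  f u = lam *: u -> u = \sum_i w i -> u = 0.
Proof.
move=> flin; elim: n w mu u => [|n IHn] w mu u fw mulam fu uE.
  by rewrite uE big_ord0.
have f0 : f 0 = 0.
  by apply/(addrI (f 0)); have := flin 1 0 0; rewrite !scale1r !addr0.
have fZ c x : f (c *: x) = c *: f x.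
  by have := flin c x 0; rewrite !addr0 f0 addr0.
have fs m (x : 'I_m -> V) : f (\sum_i x i) = \sum_i f (x i).
  elim: m x => [|m IHm] x; first by rewrite !big_ord0.
  by rewrite !big_ord_recr /= -IHm -[X in f (X + _)]scale1r flin scale1r.
pose mun := mu ord_max.
have lm : lam - mun != 0 by rewrite subr_eq0 eq_sym; apply: mulam.
apply: (scalerI lm); rewrite scaler0.
apply: (IHn (fun i => (mu (widen_ord (leqnSn n) i) - mun) *: w (widen_ord (leqnSn n) i))
            (fun i => mu (widen_ord (leqnSn n) i))) => //.
- by move=> i; rewrite fZ fw !scalerA mulrC.
- by rewrite fZ fu !scalerA mulrC.
rewrite scalerBl -fu uE fs scaler_sumr -sumrB big_ord_recr /= fw subrr addr0.
by apply: eq_bigr => i _; rewrite fw -scalerBl.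
Qed.

(** * Module action, parity and singular vectors *)

Section Modules.
Variables (K : numFieldType) (V : lmodType K) (Vp : bool -> set V).
Variables (rho : hatA K -> V -> V) (xi : {scalar hatA0 K}).
Hypothesis rho_mod : hatA_module Vp rho.
Implicit Types (x y z : hatA K) (h : hatA0 K) (m n : int) (u w : V).

Lemma rhoD x u w : rho x (u + w) = rho x u + rho x w.
Proof. by have := hatA_module_linearr rho_mod x 1 u w; rewrite !scale1r. Qed.

Lemma rho0 x : rho x 0 = 0.
Proof. by apply/(addrI (rho x 0)); rewrite -rhoD !addr0. Qed.

Lemma rhoZ x c u : rho x (c *: u) = c *: rho x u.
Proof. by have := hatA_module_linearr rho_mod x c u 0; rewrite rho0 !addr0. Qed.

Lemma rho_sum x (I : Type) (r : seq I) (F : I -> V) :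
  rho x (\sum_(i <- r) F i) = \sum_(i <- r) rho x (F i).
Proof.
by elim: r => [|i r IHr]; rewrite ?big_nil ?rho0 // !big_cons rhoD IHr.
Qed.

Lemma rhoDl x y u : rho (x + y) u = rho x u + rho y u.
Proof. by have := hatA_module_linearl rho_mod u 1 x y; rewrite !scale1r. Qed.

Lemma rho0l u : rho 0 u = 0.
Proof. by apply/(addrI (rho 0 u)); rewrite -rhoDl !addr0. Qed.

Lemma rhoZl c x u : rho (c *: x) u = c *: rho x u.
Proof. by have := hatA_module_linearl rho_mod u c x 0; rewrite rho0l !addr0. Qed.

Lemma rho_suml u (I : Type) (r : seq I) (F : I -> hatA K) :
  rho (\sum_(i <- r) F i) u = \sum_(i <- r) rho (F i) u.
Proof.
by elim: r => [|i r IHr]; rewrite ?big_nil ?rho0l // !big_cons rhoDl IHr.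
Qed.

Lemma rho_commute m n y x u : hatA_deg m y -> hatA_deg n x ->
  rho y (rho x u) =
  rho (bracket_hatA y x) u + (-1) ^+ (odd `|m| && odd `|n|) *: rho x (rho y u).
Proof.
by move=> ym xn; rewrite (hatA_module_bracket rho_mod _ ym xn) subrK.
Qed.

Lemma rho_parity m p x u :
  hatA_deg m x -> Vp p u -> Vp (odd `|m| (+) p) (rho x u).
Proof. by have := hatA_module_parity rho_mod; apply. Qed.

(** The decomposition of 0 into even and odd parts is unique. *)
Lemma parity_direct p u w : Vp p u -> Vp (~~ p) w -> u + w = 0 -> u = 0.
Proof.
have [Vsub /(_ 0)[[u' w'] [_ uniq]]] := hatA_module_super rho_mod.
have V0 q : Vp q 0 by case: (Vsub q).
have E0 : (u', w') = (0, 0) by apply: uniq; split; rewrite ?addr0.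
case: p => Vu Vw uw0.
  have : (u', w') = (w, u) by apply: uniq; split=> //=; rewrite addrC.
  by rewrite E0 => -[].
have : (u', w') = (u, w) by apply: uniq; split.
by rewrite E0 => -[].
Qed.

(** The highest weight conditions without nonvanishing and generation. In this form they pass to the
    parity components of [v], which is not assumed even or odd. *)
Definition singular u : Prop :=
  (forall h, rho h u = xi h *: u) /\
  (forall m x, 0 < m -> hatA_deg m x -> rho x u = 0).

(** A homogeneous element sends u and w into opposite parities, so each condition on u + w splits
    into one on u and one on w. *)
Lemma singular_parity p u w :
  Vp p u -> Vp (~~ p) w -> singular (u + w) -> singular u.
Proof.
have [Vsub _] := hatA_module_super rho_mod.
move=> Vu Vw [uh upos]; split=> [h|m x m0 xm].
  have /asboolP h0 := hatA0_valP h.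
  apply/eqP; rewrite -subr_eq0; apply/eqP.
  apply: (@parity_direct p _ (rho h w - xi h *: w)).
  - rewrite addrC -scaleNr; case: (Vsub p) => _; apply => //.
    by have := rho_parity h0 Vu; rewrite absz0.
  - rewrite addrC -scaleNr; case: (Vsub (~~ p)) => _; apply => //.
    by have := rho_parity h0 Vw; rewrite absz0.
  by rewrite addrACA -rhoD uh scalerDr -opprD subrr.
apply: (@parity_direct (odd `|m| (+) p) _ (rho x w)).
- exact: rho_parity xm Vu.
- by rewrite -addbN; exact: rho_parity xm Vw.
by rewrite -rhoD (upos m).
Qed.

Lemma hatA_deg0 x : hatA_deg 0 x -> x \in hatA0_pred (K:=K).
Proof. by move=> x0; apply/asboolP. Qed.

(* The adjoint action of this diagonal element is minus the degree, so the
   grading of a highest weight module is visible from its eigenvalues. *)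
Definition grading_elt : hatA K := diagA 0 (fun i => i%:~R) 0.

Definition grading_elt0 : hatA0 K := HatA0 (hatA_deg0 (diagA_deg 0 (fun i => i%:~R) 0)).

Lemma bracket_grading_elt m x : hatA_deg m x ->
  bracket_hatA grading_elt x = (- m%:~R) *: x.
Proof.
move=> xm; have g0 : hatA_deg 0 grading_elt by apply: diagA_deg.
apply: hatA_eq => [i j|]; rewrite ?entZ ?cpartZ.
  rewrite (ent_bracket _ _ g0 xm) addr0 /= mul1r !ent_diagA.
  have [->|jim] := eqVneq j (i + m); last first.
    rewrite (ent_deg xm jim) (_ : j - (i + m) == 0 = false) ?mulr0 ?subr0 //.
    by rewrite subr_eq0; apply/negbTE.
  rewrite !subrr eqxx /=; have [->|i0] := eqVneq i 0.
    by rewrite ent_axis ?mulr0 ?mul0r ?subr0 //; left.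
  have [->|im0] := eqVneq (i + m) 0.
    by rewrite [ent x i 0]ent_axis ?mulr0 ?mul0r ?subr0 //; right.
  by rewrite /= intrD; ring.
rewrite (cpart_bracket _ g0) fsbig1 => [|r _]; last first.
  by rewrite addr0 subrr !mul0r mulr0.
have [->|m0] := eqVneq m 0; first by rewrite oppr0 mul0r.
by rewrite (cpart_deg xm m0) mulr0.
Qed.

(** * Finite dimension in degree -1/2 makes the weight vanish on far diagonals *)

Variable v : V.
Hypotheses (v_neq0 : v != 0) (v_singular : singular v).

(** With coefficient sequences i^n, a linear dependence among [size s + 1] vectors yields a nonzero
    polynomial sequence, which vanishes at finitely many integers only. *)
Lemma annihilating_sequence :
  finite_dimensional [set rho x v | x in hatA_deg (-1)] ->
  exists (a : int -> K) (B : nat), rho (diagA (-1) a 0) v = 0 /\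
    forall i : int, (B < `|i|)%N -> a i != 0.
Proof.
move=> [s sE]; pose x (n : nat) : hatA K := diagA (-1) (fun i => i%:~R ^+ n) 0.
have xs (n : 'I_(size s).+1) : lspan [set` s] (rho (x n) v).
  by rewrite -sE; exists (x n) => //; apply: diagA_deg.
have [c c0 cx] := lspan_seq_dependent (ltnSn _) xs.
pose p : {poly K} := \poly_(n < (size s).+1) c 0 (inord n).
have p0 : p != 0.
  apply: contra_neq c0 => p0; apply/rowP => n; rewrite mxE.
  have : p`_n = c 0 n by rewrite coef_poly ltn_ord inord_val.
  by rewrite p0 coef0 => <-.
have [B pB] := int_roots_bounded p0.
exists (fun i => p.[i%:~R]), B; split=> //.
rewrite (_ : diagA _ _ _ = \sum_n c 0 n *: x n).
  by rewrite rho_suml -[RHS]cx; apply: eq_bigr => n _; rewrite rhoZl.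
apply: hatA_eq => [i j|]; last first.
  by rewrite cpart_sum big1 // => n _; rewrite cpartZ cpart_diagA mulr0.
rewrite ent_sum ent_diagA horner_poly.
case: ifP => ij.
  by apply: eq_bigr => n _; rewrite entZ ent_diagA ij inord_val.
by rewrite big1 // => n _; rewrite entZ ent_diagA ij mulr0.
Qed.

(** Such an h is a bracket [y, x] with x v = 0 by construction of x and y v = 0 by positive degree,
    so xi(h) v = h v = 0. *)
Lemma finite_dimensional_xi_far :
  finite_dimensional [set rho x v | x in hatA_deg (-1)] ->
  exists B : nat, forall h, cpart h = 0 ->
    (forall s, (`|s| <= B)%N -> ent h s s = 0) -> xi h = 0.
Proof.
move=> /annihilating_sequence[a [B [xv aB]]]; exists B => h ch hB.
have [c [cE cB]] := telescoping_solution hB.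
pose x := diagA (-1) a 0; pose y := diagA 1 (fun i => c i / a (i + 1)) 0.
have x1 : hatA_deg (-1) x by apply: diagA_deg.
have y1 : hatA_deg 1 y by apply: diagA_deg.
have /asboolP h0 := hatA0_valP h.
have yxE : bracket_hatA y x = h.
  have ca i : c i / a (i + 1) * a (i + 1) = c i.
    (* Where a_{i+1} may vanish, c_i is 0 anyway. *)
    have [iB|iB] := leqP (absz (i + 1)%R) B; first by rewrite cB ?iB ?orbT // !mul0r.
    by rewrite divfK // aB.
  apply: hatA_eq => [i j|]; last first.
    rewrite ch (cpart_bracket _ y1) fsbig1 // => r _.
    (* Only r = 0 separates r <= 0 from r + 1 <= 0, and row 0 of [y] vanishes. *)
    rewrite [ent y _ _]ent_diagA; case: ifP => [/and3P[_ r0 r1]|_].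
      by rewrite (_ : (r + 1 <= 0)%R = (r <= 0)%R) ?subrr ?mul0r ?mulr0 //; lia.
    by rewrite !(mulr0, mul0r).
  have [->|ji] := eqVneq j i; last first.
    by rewrite (ent_deg h0) ?addr0 // (ent_deg (bracket_deg y1 x1)) // subrr addr0.
  have [->|i0] := eqVneq i 0; first by rewrite !ent_axis //; left.
  rewrite (ent_bracket _ _ y1 x1) /= expr1 mulN1r opprK !ent_diagA.
  have -> : i + 1 - i == 1 by lia.
  have -> : i - (i + 1) == - 1 by lia.
  have -> : i - 1 - i == - 1 by lia.
  have -> : i - (i - 1) == 1 by lia.
  rewrite i0 /= -[RHS]cE; congr (_ + _).
    (* When a neighbour of i is the excluded index 0, its product drops out, and the matching value
       of c is 0 as well. *)
    have [i1|i1] := eqVneq (i + 1) 0; last exact: ca.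
    by rewrite mul0r cB // i1 orbT.
  rewrite ?andbT.
  have [i1|i1] := eqVneq (i - 1) 0; first by rewrite mul0r cB // i1.
  by rewrite mulrC -[in RHS]ca subrK.
have : rho h v = 0.
  have [_ /(_ 1 y) yv] := v_singular; have := rho_commute v y1 x1.
  by rewrite yxE xv yv // !rho0 scaler0 addr0.
have [-> _] := v_singular; move/eqP; rewrite scaler_eq0 (negPf v_neq0) orbF.
by move/eqP.
Qed.

(** * The submodule generated by far elements of negative degree *)

Variable N : nat.
Hypothesis xi_far : forall h,
  cpart h = 0 -> (forall s, (`|s| <= N)%N -> ent h s s = 0) -> xi h = 0.

Lemma far_weight u x : singular u -> hatA_deg 0 x -> far N x -> rho x u = 0.
Proof.
move=> [uh _] x0 [cx xN].
rewrite (uh (HatA0 (hatA_deg0 x0))) xi_far ?scale0r //= => s sN.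
by apply: xN; rewrite sN.
Qed.

(** The margin |m| beyond N is what a raising element of degree at most -m can consume in a bracket
    with x. The vector u is taken of definite parity so that the span is stable under taking parity
    components. *)
Inductive far_orbit : V -> Prop :=
| FarVector p u m x : singular u -> Vp p u -> m < 0 -> hatA_deg m x ->
    far (N + `|m|) x -> far_orbit (rho x u)
| FarStep m z u : m < 0 -> hatA_deg m z -> far_orbit u -> far_orbit (rho z u).

(** Each letter of degree m adds -m > 0 to the eigenvalue, and there is at least one letter. *)
Lemma far_orbit_eigenvector u : far_orbit u -> exists2 m : int, 0 < m &
  rho grading_elt u = (xi grading_elt0 + m%:~R) *: u.
Proof.
have g0 : hatA_deg 0 grading_elt by apply: diagA_deg.
elim=> [p {}u m x [uh _] _ m0 xm _|m z {}u m0 zm _ [k k0 uk]].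
  exists (- m); first by rewrite oppr_gt0.
  rewrite (rho_commute _ g0 xm) (bracket_grading_elt xm) rhoZl /= scale1r.
  by rewrite (uh grading_elt0) rhoZ -scalerDl addrC rmorphN.
exists (k - m); first by rewrite subr_gt0 (lt_trans m0).
rewrite (rho_commute _ g0 zm) (bracket_grading_elt zm) rhoZl /= scale1r uk.
by rewrite rhoZ -scalerDl intrB; congr (_ *: _); ring.
Qed.

Lemma far_orbit_parity u : far_orbit u -> exists p, Vp p u.
Proof.
elim=> [p {}u m x _ Vu _ xm _|m z {}u _ zm _ [p Vu]].
  by eexists; exact: rho_parity xm Vu.
by eexists; exact: rho_parity zm Vu.
Qed.

(** A letter of negative degree extends the word; any other is commuted inwards until it meets the
    far letter. There the bracket is far of degree m + n: it gives a new generator, acts by a zero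
    weight, or raises a singular vector, according to the sign of m + n. *)
Lemma far_orbit_closed y u : far_orbit u -> lspan far_orbit (rho y u).
Proof.
have subW := lspan_subspace far_orbit.
have stable_neg m z w : m < 0 -> hatA_deg m z ->
    lspan far_orbit w -> lspan far_orbit (rho z w).
  move=> m0 zm [n [c [f [ff ->]]]]; rewrite rho_sum; apply: subspace_sum => // i _.
  by rewrite rhoZ; apply: subspaceZ => //; apply/sub_lspan/(FarStep m0 zm).
suff homog m z w : hatA_deg m z -> far_orbit w -> lspan far_orbit (rho z w).
  move=> uW; have [n [c [f [ff ->]]]] := homogeneous_span y.
  rewrite rho_suml; apply: subspace_sum => // i _; rewrite rhoZl.
  by apply: subspaceZ => //; have [m _ fm] := ff i; apply: homog fm uW.
move=> zm wW; elim: wW m z zm => {w}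
    [p w n x w_sing Vw n0 xn xfar|n x w n0 xn wW IHw] m z zm.
  have [m0|m0] := ltP m 0.
    exact/sub_lspan/(FarStep m0 zm)/(FarVector w_sing Vw n0 xn).
  rewrite (rho_commute _ zm xn); apply: subspaceD => //; last first.
    apply: subspaceZ => //; have [mE|mn0] := eqVneq m 0; last first.
      by case: w_sing => _ /(_ m z) ->; rewrite ?rho0 //; [case: subW | lia].
    rewrite mE in zm; have [/(_ (HatA0 (hatA_deg0 zm)))/= -> _] := w_sing.
    by rewrite rhoZ; apply: subspaceZ => //; apply/sub_lspan/(FarVector w_sing Vw n0 xn).
  (* The available radius N + |n| - |m| equals N + |m + n| when m + n <= 0. *)
  have bfar (D : nat) : (`|m| <= N + `|n|)%N -> (D <= N + `|n| - `|m|)%N ->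
      far D (bracket_hatA z x).
    move=> mD DD; apply: far_le DD _; exact: far_bracket zm xn xfar.
  have bdeg := bracket_deg zm xn.
  have [mn0|mn0] := ltP (m + n) 0.
    by apply/sub_lspan/(FarVector w_sing Vw mn0 bdeg)/bfar; lia.
  have [mnE|mnN] := eqVneq (m + n) 0.
    rewrite far_weight //; [by case: subW | by rewrite -mnE | apply: bfar; lia].
  by case: w_sing => _ /(_ (m + n)) -> //; [case: subW | lia].
have [m0|m0] := ltP m 0; first exact/sub_lspan/(FarStep m0 zm)/(FarStep n0 xn).
rewrite (rho_commute _ zm xn); apply: subspaceD => //.
  exact: IHw (bracket_deg zm xn).
by apply: subspaceZ => //; apply: stable_neg n0 xn _; apply: IHw zm.
Qed.

(** Generators have definite parity, so grouping a combination by parity gives its even and odd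
    components. *)
Lemma far_orbit_submodule : hatA_submodule Vp rho (lspan far_orbit).
Proof.
have subW := lspan_subspace far_orbit.
have [Vsub Vuniq] := hatA_module_super rho_mod.
split=> // [x _ [n [c [w [ww ->]]]]|u0 u1 Vu0 Vu1 [n [c [w [ww uE]]]]].
  rewrite rho_sum; apply: subspace_sum => // i _.
  by rewrite rhoZ; apply: subspaceZ => //; apply: far_orbit_closed.
have /choice[p wp] := fun i => far_orbit_parity (ww i).
have part q : exists2 e, Vp q e /\ lspan far_orbit e &
    e = \sum_(i | p i == q) c i *: w i.
  eexists; last by [].
  split; apply: subspace_sum => // i /eqP pq; apply: subspaceZ => //.
    by rewrite -pq; apply: wp.
  exact/sub_lspan.
have [e0 [V0 W0] e0E] := part false; have [e1 [V1 W1] e1E] := part true.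
have eE : u0 + u1 = e0 + e1.
  rewrite uE (bigID (fun i => p i == false)) /= -e0E; congr (_ + _).
  by rewrite e1E; apply: eq_bigl => i; case: (p i).
have [w' [_ uniq]] := Vuniq (u0 + u1).
have : (u0, u1) = (e0, e1).
  by transitivity w'; [apply/esym|]; apply: uniq; split.
by case=> -> ->.
Qed.

(** The grading eigenvalue of a singular vector differs from those of all generators by positive
    integers. *)
Lemma far_orbit_proper u : singular u -> lspan far_orbit u -> u = 0.
Proof.
move=> [uh _] [n [c [w [ww uE]]]].
have /choice[k wk] i : exists k : int, 0 < k /\
    rho grading_elt (w i) = (xi grading_elt0 + k%:~R) *: w i.
  by have [k k0 wk] := far_orbit_eigenvector (ww i); exists k.
apply: (eigenvectors_sum_eq0 (f := rho grading_elt) _ _ _ (uh grading_elt0) uE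
  (mu := fun i => xi grading_elt0 + (k i)%:~R)).
- exact: hatA_module_linearr rho_mod _.
- by move=> i; rewrite rhoZ (wk i).2 !scalerA mulrC.
move=> i; rewrite -subr_eq0 addrC addKr intr_eq0.
by have [k0 _] := wk i; rewrite gt_eqF.
Qed.

(** * Coordinates of the weight *)

Definition mx_unit0 i : hatA0 K :=
  HatA0 (hatA_deg0 (diagA_deg 0 (fun i' => (i' == i)%:R) 0)).

Definition central0 : hatA0 K := HatA0 (hatA_deg0 (diagA_deg 0 (fun=> 0) 1)).

(** Removing the near diagonal entries and the central part from h leaves a far element, which kills
    v; coefficients of the nonzero v are then compared. *)
Lemma weight_expansion h : xi h =
  \sum_(i <- int_range N) xi (mx_unit0 i) * ent h i i + xi central0 * cpart h.
Proof.
have /asboolP h0 := hatA0_valP h; have [vh _] := v_singular.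
have [y [y0 cy yN hE]] := near_far_decomposition N h0.
have C0 : hatA_deg 0 (diagA 0 (fun=> 0 : K) 1) by apply: diagA_deg.
set e := RHS; suff : xi h *: v = e *: v.
  move/eqP; rewrite -subr_eq0 -scalerBl scaler_eq0 (negPf v_neq0) orbF.
  by rewrite subr_eq0 => /eqP.
rewrite {}/e -vh [X in rho X v]hE rhoDl rho_suml scalerDl scaler_suml; congr (_ + _).
  apply: eq_bigr => i _; rewrite rhoZl addr0 (vh (mx_unit0 i)) scalerA.
  by congr (_ *: _); apply: mulrC.
(* The remainder [y] still carries the central part of h, so it becomes far only after that multiple
   of C is subtracted. *)
rewrite mulrC -scalerA -(vh central0) -rhoZl.
apply/eqP; rewrite -subr_eq0 -scaleN1r -rhoZl -rhoDl addrC; apply/eqP.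
apply: far_weight => //.
  have sub0 := hatA_deg_subspace K 0.
  by case: (sub0) => _; apply => //; apply: subspaceZ C0.
have EC c i j : ent (c *: diagA 0 (fun=> 0 : K) 1) i j = 0.
  by rewrite entZ ent_diagA if_same mulr0.
split=> [|i j ij]; rewrite ?ent_linear ?cpart_linear.
  by rewrite cpartZ cpart_diagA eqxx mulr1 mulN1r cy addNr.
rewrite EC mulr0 add0r; have [jE|ji] := eqVneq j i; last by rewrite (ent_deg y0) ?addr0.
by apply: yN; lia.
Qed.

(** * Irreducibility: far elements annihilate words of bounded degree *)

Hypothesis rho_irr : irreducible_module Vp rho.

(** In negative degree, irreducibility makes the span of [far_orbit] zero or everything; the latter
    would contain v, against [far_orbit_proper]. *)
Lemma far_singular m x : hatA_deg m x -> far (N + `|m|) x -> rho x v = 0.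
Proof.
move=> xm xfar; have [m0|m0|mE] := ltgtP m 0; last first.
- by rewrite mE in xm xfar; rewrite far_weight //; move: xfar; rewrite addn0.
- by case: v_singular => _; apply; first exact: m0.
(* [far_orbit] starts from vectors of definite parity, so the even and odd components of v are
   treated separately. *)
have [_ /(_ v)[[v0 v1] /= [[V0 V1 vE] _]]] := hatA_module_super rho_mod.
have v0s : singular v0.
  by apply: (@singular_parity false _ v1); rewrite -?vE.
have v1s : singular v1.
  by apply: (@singular_parity true _ v0) => //; rewrite addrC -vE.
have [W0|WT] := (rho_irr.2 _ far_orbit_submodule).
  have far0 p u : singular u -> Vp p u -> rho x u = 0.
    move=> us Vu; suff : lspan far_orbit (rho x u) by rewrite W0.
    exact/sub_lspan/(FarVector us Vu m0 xm).
  by rewrite vE rhoD (far0 false) // (far0 true) // addr0.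
case/eqP: v_neq0; apply: far_orbit_proper => //; by rewrite WT.
Qed.

Lemma word_deg_le0 (xs : seq (int * hatA K)) :
  (forall q, q \in xs -> q.1 < 0 /\ hatA_deg q.1 q.2) -> \sum_(q <- xs) q.1 <= 0.
Proof. by move=> xs0; rewrite big_seq; apply: sumr_le0 => q /xs0[/ltW]. Qed.

(** Passing a letter of degree n costs 2|n|: the bracket loses |n| of radius, and its degree m + n
    may exceed m by |n| in absolute value. *)
Lemma far_word (xs : seq (int * hatA K)) m x :
  (forall q, q \in xs -> q.1 < 0 /\ hatA_deg q.1 q.2) ->
  hatA_deg m x -> far (N + `|m| + (absz (\sum_(q <- xs) q.1)).*2) x ->
  rho x (foldr (fun q => rho q.2) v xs) = 0.
Proof.
elim: xs m x => [|[n y] xs IHxs] m x xsneg xm xfar.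
  by apply: far_singular xm _; apply: far_le xfar; lia.
have [/= n0 yn] : n < 0 /\ hatA_deg n y by apply: (xsneg (n, y)); rewrite mem_head.
have xs'neg q : q \in xs -> q.1 < 0 /\ hatA_deg q.1 q.2.
  by move=> qxs; apply: xsneg; rewrite inE qxs orbT.
have := word_deg_le0 xs'neg; move: xfar; rewrite big_cons /=.
set S := \sum_(q <- xs) q.1 => xfar S0.
have xyE : rho (bracket_hatA y x) (foldr (fun q => rho q.2) v xs) = 0.
  apply: IHxs (bracket_deg yn xm) _ => //.
  by apply: far_le (far_bracket _ yn xm xfar); lia.
have xE : rho x (foldr (fun q => rho q.2) v xs) = 0.
  by apply: IHxs xm _ => //; apply: far_le xfar; lia.
have := rho_commute (foldr (fun q => rho q.2) v xs) yn xm.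
rewrite xyE xE rho0 add0r => /esym/eqP; rewrite scaler_eq0 signr_eq0 /=.
by move/eqP.
Qed.

Lemma far_module_deg k m x u :
  module_deg rho v k u -> hatA_deg m x -> far (N + `|m| + `|k|.*2) x ->
  rho x u = 0.
Proof.
move=> [n [c [w [ww ->]]]] xm xfar; rewrite rho_sum big1 // => i _; rewrite rhoZ.
have [xs [xsneg xsk ->]] := ww i.
by rewrite (far_word xsneg xm) ?scaler0 // xsk.
Qed.

(** * Finite dimension of the graded pieces *)

Lemma module_deg_step k m x u : m < 0 -> hatA_deg m x ->
  module_deg rho v k u -> module_deg rho v (m + k) (rho x u).
Proof.
move=> m0 xm [n [c [w [ww ->]]]]; rewrite rho_sum.
apply: subspace_sum => [|i _]; first exact: lspan_subspace.
rewrite rhoZ; apply: subspaceZ; first exact: lspan_subspace.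
apply: sub_lspan; have [xs [xsneg xsk ->]] := ww i.
exists ((m, x) :: xs); split=> //; last by rewrite big_cons xsk.
by move=> q; rewrite inE => /predU1P[->|/xsneg].
Qed.

Lemma module_deg_pos k : 0 < k -> module_deg rho v k = lspan [set` [::]].
Proof.
move=> k0; apply/seteqP; split; apply: lspan_min; try exact: lspan_subspace.
  by move=> _ [xs [xsneg xsk ->]]; have := word_deg_le0 xsneg; rewrite xsk leNgt k0.
by [].
Qed.

Lemma module_deg0 : module_deg rho v 0 = lspan [set` [:: v]].
Proof.
apply/seteqP; split; apply: lspan_min; try exact: lspan_subspace.
  move=> _ [[|[m x] xs] [xsneg xs0 ->]]; first by apply: sub_lspan; rewrite /= mem_head.
  have [/= m0 _] := xsneg _ (mem_head _ _).
  have : \sum_(q <- xs) q.1 <= 0.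
    by apply: word_deg_le0 => q qxs; apply: xsneg; rewrite inE qxs orbT.
  by move: xs0; rewrite big_cons /=; lia.
move=> u /=; rewrite inE => /eqP->; apply: sub_lspan.
by exists [::]; split=> //; rewrite big_nil.
Qed.

(** Strong induction on |k|: the first letter of a word, of degree -l, may be replaced by near
    matrix units, since its far remainder kills the rest of the word, which lies in M_{-(k-l)}. *)
Lemma module_deg_finite_dimensional k : finite_dimensional (module_deg rho v k).
Proof.
have [k0|k0] := ltP 0 k; first by exists [::]; exact: module_deg_pos.
have -> : k = - `|k|%N%:Z by lia.
elim/ltn_ind: {k k0}`|k|%N => k IHk.
have [->|k_gt0] := posnP k; first by exists [:: v]; rewrite oppr0 module_deg0.
have /choice[s sE] l : exists sl : seq V,
    (l < k)%N -> module_deg rho v (- l%:Z) = lspan [set` sl].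
  by have [/IHk[sl slE]|] := ltnP l k; [exists sl|exists [::]].
(* In degree -l, rows beyond B have columns beyond N + 2k - l = N + l + 2(k - l), the radius that
   [far_module_deg] asks for on M_{-(k-l)}. *)
pose B := (N + k.*2)%N.
exists (flatten [seq [seq rho (mx_unit K (- l%:Z) i) w
  | i <- int_range B, w <- s (k - l)%N] | l <- iota 1 k]).
apply/seteqP; split; apply: lspan_min; try exact: lspan_subspace; last first.
  move=> u /flatten_mapP[l]; rewrite mem_iota => lk /allpairsPdep[i [w [_ ws ->]]].
  rewrite (_ : - k%:Z = - l%:Z + - (k - l)%N%:Z); last lia.
  apply: module_deg_step; [lia | exact: diagA_deg | rewrite sE; last lia].
  exact: sub_lspan.
move=> _ [[|[m x] xs] [xsneg xsk ->]]; first by move: xsk; rewrite big_nil; lia.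
have [/= m0 xm] := xsneg _ (mem_head _ _).
have xs'neg q : q \in xs -> q.1 < 0 /\ hatA_deg q.1 q.2.
  by move=> qxs; apply: xsneg; rewrite inE qxs orbT.
have S0 := word_deg_le0 xs'neg.
have {}xsk : m + \sum_(q <- xs) q.1 = - k%:Z by rewrite -xsk big_cons.
pose l := `|m|%N; have mE : m = - l%:Z by lia.
have xs_deg : module_deg rho v (- (k - l)%N%:Z) (foldr (fun q => rho q.2) v xs).
  by apply: sub_lspan; exists xs; split=> //; apply: (addrI m); rewrite xsk; lia.
have [y [ym cy yB ->]] := near_far_decomposition B xm.
rewrite rhoDl (far_module_deg xs_deg ym); last first.
  split=> [|i j ij]; first by rewrite cy (cpart_deg xm) //; lia.
  have [jE|jim] := eqVneq j (i + m); last exact: ent_deg ym jim.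
  by apply: yB; lia.
have subW := lspan_subspace; rewrite addr0 rho_suml big_seq.
apply: subspace_sum => // i iB; rewrite rhoZl; apply: subspaceZ => //.
have lk : (l < k.+1)%N && (0 < l)%N by lia.
move: xs_deg; rewrite sE; last lia.
move=> [n [c [w [ws ->]]]]; rewrite rho_sum; apply: subspace_sum => // j _.
rewrite rhoZ; apply: subspaceZ => //; apply: sub_lspan.
apply/flatten_mapP; exists l; first by rewrite mem_iota; lia.
by apply/allpairsPdep; exists i, (w j); rewrite -mE; split=> //; apply: ws.
Qed.

(** Degrees are doubled, so -1 is the largest negative degree and a word of total degree -1 has
    exactly one letter. *)
Lemma module_degN1 : module_deg rho v (-1) = [set rho x v | x in hatA_deg (-1)].
Proof.
apply/seteqP; split; last first.
  move=> _ [x x1 <-]; rewrite -[-1]addr0; apply: module_deg_step => //.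
  by rewrite module_deg0; apply: sub_lspan; rewrite /= mem_head.
apply: lspan_min => [|_ [[|[m x] xs] [xsneg xs1 ->]]].
- have [d0 dD] := hatA_deg_subspace K (-1).
  split=> [|c _ _ [x x1 <-] [y y1 <-]]; first by exists 0; rewrite ?rho0l.
  by exists (c *: x + y); [exact: dD | rewrite rhoDl rhoZl].
- by move: xs1; rewrite big_nil.
have [/= m0 xm] := xsneg _ (mem_head _ _).
have xs'neg q : q \in xs -> q.1 < 0 /\ hatA_deg q.1 q.2.
  by move=> qxs; apply: xsneg; rewrite inE qxs orbT.
move: xs1; case: xs xsneg xs'neg => [|[n y] xs] xsneg xs'neg.
  by rewrite big_cons big_nil addr0 => mE; exists x => //; rewrite -mE.
have [/= n0 _] := xs'neg _ (mem_head _ _).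
have : \sum_(q <- xs) q.1 <= 0.
  by apply: word_deg_le0 => q' q'xs; apply: xs'neg; rewrite inE q'xs orbT.
by rewrite !big_cons; set S := \sum_(q <- xs) q.1 => S0 /= mnS; lia.
Qed.

End Modules.

(** * Equivalence of the three conditions *)

Lemma singular_highest_weight (K : numFieldType) (V : lmodType K)
    (rho : hatA K -> V -> V) (xi : {scalar hatA0 K}) (v : V) :
  highest_weight_vector rho xi v -> singular rho xi v.
Proof.
move=> [_ vh vpos _]; split=> // m x m0 xm; apply: vpos.
by apply: sub_lspan; exists m.
Qed.

Lemma int_range_setE (B : nat) :
  [set s : int | s != 0 /\ (`|s| <= B)%N] = [set` [seq i <- int_range B | i != 0]].
Proof.
by apply/seteqP; split=> s /=; rewrite mem_filter mem_int_range => /andP.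
Qed.

Theorem theorem4p5 (R : realType) (V : lmodType R[i]) (Vp : bool -> set V)
    (rho : hatA R[i] -> V -> V) (xi : {scalar hatA0 R[i]}) (v : V) :
  hatA_module Vp rho ->
  irreducible_module Vp rho ->
  highest_weight_vector rho xi v ->
  [<-> quasi_finite rho v;
       finite_dimensional [set rho x v | x in hatA_deg (-1)];
       exists N : nat, (0 < N)%N /\
         exists (c : int -> R[i]) (d : R[i]), forall h : hatA0 R[i],
           xi h = \sum_(s \in [set s : int | s != 0 /\ (`|s| <= N.*2)%N])
                    c s * omega s h
                  + d * Lambda0 h ].

Proof.
move=> rho_mod rho_irr hwv; have v_sing := singular_highest_weight hwv.
have [v0 _ _ _] := hwv.
tfae.
- by move=> /(_ (-1)); rewrite (module_degN1 rho_mod).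
- move=> /(finite_dimensional_xi_far rho_mod v0 v_sing)[B xiB].
  (* The successor makes the bound positive; its double still exceeds B. The coefficients are the
     values of xi on diagonal matrix units and on C. *)
  exists B.+1; split=> //.
  exists (fun s => xi (mx_unit0 _ s)), (xi (central0 _)) => h.
  have xi_far (h' : hatA0 R[i]) : cpart h' = 0 ->
      (forall s, (`|s| <= B.+1.*2)%N -> ent h' s s = 0) -> xi h' = 0.
    by move=> ch' hB; apply: xiB => // s sB; apply: hB; lia.
  rewrite (weight_expansion rho_mod v0 v_sing xi_far).
  rewrite int_range_setE -fsbig_seq ?filter_uniq ?int_range_uniq // big_filter.
  (* The expansion runs over the whole interval; its term at 0 vanishes because row 0 does. *)
  congr (_ + _); rewrite [LHS](bigID (fun i => i == 0)) /= big1 ?add0r // => i /eqP->.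
  by rewrite ent_axis ?mulr0 //; left.
move=> [N [_ [c [d xiE]]]] k.
have xi_far (h : hatA0 R[i]) : cpart h = 0 ->
    (forall s, (`|s| <= N.*2)%N -> ent h s s = 0) -> xi h = 0.
  move=> ch hN; rewrite xiE [Lambda0 h]ch mulr0 addr0 fsbig1 // => s [_ sN].
  by rewrite [omega s h]hN ?mulr0.
by have := module_deg_finite_dimensional rho_mod v0 v_sing xi_far rho_irr k.
Qed.
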